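(* For every level $\ell\in\{1,2\}$ and all sets $\Gamma,\Delta$ of propositional formulas, $$\mathsf{G}_{\mathbf{SPL}}\vdash \Gamma\Rightarrow^{\ell}\Delta \quad\text{if and only if}\quad \mathsf{G}_{\mathbf{S}}\vdash \Gamma^{\mathcal V}\Rightarrow^{\ell}\Delta^{\mathcal V}.$$
   Context: Propositional formulas are built from propositional variables and $\bot$ using $\land,\lor,\to$; modal formulas additionally use $\Box$. For a set $\Gamma$ of modal formulas, $\Box\Gamma=\{\Box A: A\in\Gamma\}$. Visser's Gödel translation $(\cdot)^{\mathcal V}$ from propositional to modal formulas: $p^{\mathcal V}=p\land\Box p$ for variables $p$; $\bot^{\mathcal V}=\bot$; $(A\land B)^{\mathcal V}=A^{\mathcal V}\land B^{\mathcal V}$; $(A\lor B)^{\mathcal V}=A^{\mathcal V}\lor B^{\mathcal V}$; $(A\to B)^{\mathcal V}=\Box(A^{\mathcal V}\to B^{\mathcal V})$. For a set, $\Gamma^{\mathcal V}=\{A^{\mathcal V}:A\in\Gamma\}$. A sequent $\Gamma\Rightarrow^{\ell}\Delta$ of level $\ell\in\{1,2\}$ consists of two sets $\Gamma,\Delta$ of formulas; commas denote union of sets and $A,\Gamma$ means $\{A\}\cup\Gamma$ (so contraction is built in). $\mathsf G\vdash S$ means that $S$ is derivable in $\mathsf G$. Rules are written ''premises / conclusion''; $\Gamma,\Delta,\Sigma$ are arbitrary sets of formulas and $A,B$ arbitrary formulas of the relevant language. Common rules, for each $\ell\in\{1,2\}$: - axioms $p\Rightarrow^{\ell}p$ ($p$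 a propositional variable) and $\bot\Rightarrow^{\ell}$ (empty succedent); - weakening: $\Gamma\Rightarrow^{\ell}\Delta$ / $A,\Gamma\Rightarrow^{\ell}\Delta$, and $\Gamma\Rightarrow^{\ell}\Delta$ / $\Gamma\Rightarrow^{\ell}\Delta,A$; - $A,B,\Gamma\Rightarrow^{\ell}\Delta$ / $A\land B,\Gamma\Rightarrow^{\ell}\Delta$; - $\Gamma\Rightarrow^{\ell}\Delta,A$ and $\Gamma\Rightarrow^{\ell}\Delta,B$ / $\Gamma\Rightarrow^{\ell}\Delta,A\land B$; - $A,\Gamma\Rightarrow^{\ell}\Delta$ and $B,\Gamma\Rightarrow^{\ell}\Delta$ / $A\lor B,\Gamma\Rightarrow^{\ell}\Delta$; - $\Gamma\Rightarrow^{\ell}\Delta,A,B$ / $\Gamma\Rightarrow^{\ell}\Delta,A\lor B$; - lift: $\Gamma\Rightarrow^{1}\Delta$ / $\Gamma\Rightarrow^{2}\Delta$. $\mathsf{G}_{\mathbf S}$ (on modal formulas) has the common rules and: - for $\ell\in\{1,2\}$: $\Gamma\Rightarrow^{\ell}\Delta,A$ and $B,\Gamma\Rightarrow^{\ell}\Delta$ / $A\to B,\Gamma\Rightarrow^{\ell}\Delta$; - for $\ell\in\{1,2\}$: $A,\Gamma\Rightarrow^{\ell}\Delta,B$ / $\Gamma\Rightarrow^{\ell}\Delta,A\to B$; - $\Box\Gamma,\Gamma,\Box A\Rightarrow^{1}A$ / $\Box\Gamma\Rightarrow^{1}\Box A$; - $A,\Gamma\Rightarrow^{2}\Delta$ /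 $\Box A,\Gamma\Rightarrow^{2}\Delta$. $\mathsf{G}_{\mathbf{SPL}}$ (on propositional formulas) has the common rules and: - at level 2 only: $\Gamma\Rightarrow^{2}\Delta,A$ and $B,\Gamma\Rightarrow^{2}\Delta$ / $A\to B,\Gamma\Rightarrow^{2}\Delta$; - at level 1 only, for every $k\ge 0$ and formulas $C_0,\dots,C_{k-1},D_0,\dots,D_{k-1}$, the rule with the $2^k$ premises $\Delta_i,\Sigma,A\to B,A\Rightarrow^{1}B,\Gamma_i$ ($0\le i<2^k$) and conclusion $\Sigma,\{C_j\to D_j:0\le j<k\}\Rightarrow^{1}A\to B$, where $\Delta_i=\{D_j:\text{the }j\text{-th binary digit of } i \text{ is }1\}$ and $\Gamma_i=\{C_j:\text{the }j\text{-th binary digit of } i\text{ is }0\}$, $0\le j<k$ (digit $j$ has weight $2^j$). Neither calculus contains a cut rule. *)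

(* Defs.v *)
From mathcomp Require Import all_boot.
From mathcomp Require Import boolp classical_sets.

Set Implicit Arguments.
Unset Strict Implicit.
Unset Printing Implicit Defensive.

Local Open Scope classical_set_scope.

Inductive pform : Type :=
| PVar of nat
| PBot
| PAnd of pform & pform
| POr of pform & pform
| PImp of pform & pform.

Inductive mform : Type :=
| MVar of nat
| MBot
| MAnd of mform & mform
| MOr of mform & mform
| MImp of mform & mform
| MBox of mform.

Fixpoint visser (A : pform) : mform :=
  match A with
  | PVar p => MAnd (MVar p) (MBox (MVar p))
  | PBot => MBot
  | PAnd A B => MAnd (visser A) (visser B)
  | POr A B => MOr (visser A) (visser B)
  | PImp A B => MBox (MImp (visser A) (visser B))
  end.

Inductive level : Set := L1 | L2.

(* Sequents are pairs of arbitrary (not a priori finite) sets of formulas.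
   [A |` Gamma] is [{A} U Gamma], with no freshness condition, so contraction
   is built in, and exchange is equality of sets. *)
Inductive GS : level -> set mform -> set mform -> Prop :=
| GS_ax l p : GS l [set MVar p] [set MVar p]
| GS_bot l : GS l [set MBot] set0
| GS_weakL l A Gamma Delta :
    GS l Gamma Delta -> GS l (A |` Gamma) Delta
| GS_weakR l A Gamma Delta :
    GS l Gamma Delta -> GS l Gamma (A |` Delta)
| GS_andL l A B Gamma Delta :
    GS l (A |` (B |` Gamma)) Delta -> GS l (MAnd A B |` Gamma) Delta
| GS_andR l A B Gamma Delta :
    GS l Gamma (A |` Delta) -> GS l Gamma (B |` Delta) ->
    GS l Gamma (MAnd A B |` Delta)
| GS_orL l A B Gamma Delta :
    GS l (A |` Gamma) Delta -> GS l (B |` Gamma) Delta ->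
    GS l (MOr A B |` Gamma) Delta
| GS_orR l A B Gamma Delta :
    GS l Gamma (A |` (B |` Delta)) -> GS l Gamma (MOr A B |` Delta)
| GS_lift Gamma Delta : GS L1 Gamma Delta -> GS L2 Gamma Delta
| GS_impL l A B Gamma Delta :
    GS l Gamma (A |` Delta) -> GS l (B |` Gamma) Delta ->
    GS l (MImp A B |` Gamma) Delta
| GS_impR l A B Gamma Delta :
    GS l (A |` Gamma) (B |` Delta) -> GS l Gamma (MImp A B |` Delta)
| GS_box A Gamma :
    GS L1 (MBox @` Gamma `|` Gamma `|` [set MBox A]) [set A] ->
    GS L1 (MBox @` Gamma) [set MBox A]
| GS_boxL A Gamma Delta :
    GS L2 (A |` Gamma) Delta -> GS L2 (MBox A |` Gamma) Delta.

Definition digit (i j : nat) : bool := odd (i %/ 2 ^ j).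

Inductive GSPL : level -> set pform -> set pform -> Prop :=
| GSPL_ax l p : GSPL l [set PVar p] [set PVar p]
| GSPL_bot l : GSPL l [set PBot] set0
| GSPL_weakL l A Gamma Delta :
    GSPL l Gamma Delta -> GSPL l (A |` Gamma) Delta
| GSPL_weakR l A Gamma Delta :
    GSPL l Gamma Delta -> GSPL l Gamma (A |` Delta)
| GSPL_andL l A B Gamma Delta :
    GSPL l (A |` (B |` Gamma)) Delta -> GSPL l (PAnd A B |` Gamma) Delta
| GSPL_andR l A B Gamma Delta :
    GSPL l Gamma (A |` Delta) -> GSPL l Gamma (B |` Delta) ->
    GSPL l Gamma (PAnd A B |` Delta)
| GSPL_orL l A B Gamma Delta :
    GSPL l (A |` Gamma) Delta -> GSPL l (B |` Gamma) Delta ->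
    GSPL l (POr A B |` Gamma) Delta
| GSPL_orR l A B Gamma Delta :
    GSPL l Gamma (A |` (B |` Delta)) -> GSPL l Gamma (POr A B |` Delta)
| GSPL_lift Gamma Delta : GSPL L1 Gamma Delta -> GSPL L2 Gamma Delta
| GSPL_impL A B Gamma Delta :
    GSPL L2 Gamma (A |` Delta) -> GSPL L2 (B |` Gamma) Delta ->
    GSPL L2 (PImp A B |` Gamma) Delta
| GSPL_impR (k : nat) (C D : 'I_k -> pform) A B Sigma :
    (forall i : 'I_(2 ^ k),
      GSPL L1
        ([set D j | j in [set j : 'I_k | digit i j]] `|` Sigma `|` [set PImp A B; A])
        (B |` [set C j | j in [set j : 'I_k | ~~ digit i j]])) ->
    GSPL L1 (Sigma `|` [set PImp (C j) (D j) | j in [set: 'I_k]])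
      [set PImp A B].

(* Main.v *)
Require Import Defs.
From mathcomp Require Import all_boot.
From mathcomp Require Import boolp classical_sets cardinality.

Local Open Scope classical_set_scope.

(** Both directions go by induction on derivations, and no cut is needed.

    From modal to propositional, every formula in a cut-free derivation of a
    translated sequent is a translation [visser X], a variable [p], a boxed
    variable, or the body [visser X -> visser Y] of a translated implication.
    Such a sequent is read propositionally by choosing sets [G] and [D] of
    propositional formulas that account for each of its formulas ([readL],
    [readR]): on the left, [p] and its boxed form both require [p] in [G], and
    a body of [X -> Y] requires [Y] in [G] or [X] in [D]; on the right, a body
    requires [X] in [G] and [Y] in [D].  A derivable modal sequent has all its
    finite readings derivable ([GSPL_of_GS]).  A reading of the conclusion of
    a rule acting on a body is already a reading of one of its premises, so
    such rules vanish.  Readings of the premise of the Löb rule choose, for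
    each body [C_j -> D_j] on the left, between [D_j] on the left and [C_j] on
    the right; these choices are what the [2 ^ k] premises of the SPL rule
    enumerate ([GSPL_impR_all]).  A boxed variable on the right occurs only
    next to the conjunct [p], whose branch of the derivation suffices.

    From propositional to modal, the [2 ^ k] premises are recombined by
    repeated left implication rules into one sequent containing the bodies
    [C_j -> D_j] ([GS_impL_finite]).  The context [Sigma] remains, and its
    translation is not boxed as the Löb rule requires.  It is split by the
    left conjunction and disjunction rules down to boxed formulas
    ([GS_split_set]).  Each resulting set of boxed formulas, once unboxed by
    the Löb rule, contains conjuncts and chosen disjuncts that make up
    [Sigma], and the admissible inversion of the left conjunction and
    disjunction rules ([GS_inversion]) turns the recombined premise into the
    one that the Löb rule asks for. *)

(** * Finite sets *)

Lemma finite_setU1 {T : Type} (x : T) {A : set T} :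
  finite_set A -> finite_set (x |` A).
Proof. by move=> fA; rewrite finite_setU; split=> //; exact: finite_set1. Qed.

Lemma finite_ind {T : Type} (P : set T -> Prop) :
  P set0 -> (forall x A, finite_set A -> P A -> P (x |` A)) ->
  forall A, finite_set A -> P A.
Proof.
move=> P0 PU A; case/(@finite_seqP {classic T})=> s ->.
elim: s => [|x s IH].
  have -> : [set` ([::] : seq {classic T})] = set0 :> set T by apply/seteqP; split.
  exact: P0.
have -> : [set` (x :: s : seq {classic T})] = x |` [set` s] :> set T.
  apply/seteqP; split=> y /=; rewrite inE.
    by case/orP=> [/eqP ->|]; [left|right].
  by case=> [->|->]; rewrite ?eqxx ?orbT.
apply: (PU x) => //.
by apply/(@finite_seqP {classic T}); exists s.
Qed.

Lemma finite_range_ord {T : Type} {A : set T} :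
  finite_set A -> exists k (f : 'I_k -> T), A = range f.
Proof.
case/(@finite_seqP {classic T})=> s ->.
exists (size s), (tnth (in_tuple s)); apply/seteqP; split=> x /=.
  by case/(tnthP (in_tuple s))=> i ->; exists i.
by case=> i _ <-; apply/(tnthP (in_tuple s)); exists i.
Qed.

Lemma setU1_absorb {T : Type} {x : T} {A : set T} : A x -> x |` A = A.
Proof. by move=> Ax; apply/seteqP; split=> y /=; [case=> [->|]|right]. Qed.

Lemma superset_closed {T : Type} (P : set T -> Prop) :
  (forall x A, P A -> P (x |` A)) ->
  forall A B, A `<=` B -> finite_set B -> P A -> P B.
Proof.
move=> PU A B sAB fB PA; move/setUidPr: sAB => <-; rewrite setUC.
move: B fB; apply: (finite_ind (fun B => P (B `|` A))) => [|x B _ IH].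
  by rewrite set0U.
by rewrite -setUA; apply: PU.
Qed.

Ltac finite_tac :=
  repeat match goal with
  | |- finite_set (_ `|` _) => rewrite finite_setU; split
  | |- finite_set [set _] => exact: finite_set1
  | |- finite_set set0 => exact: finite_set0
  | |- finite_set (_ @` _) => apply: finite_image
  | |- _ => assumption
  end.

Ltac subset_tac :=
  rewrite ?image_setU ?image_set1 ?image_set0; move=> ? /=; tauto.

(** * Structural properties of the calculi *)

Lemma GS_weaken {l G D G' D'} :
  GS l G D -> G `<=` G' -> D `<=` D' -> finite_set G' -> finite_set D' ->
  GS l G' D'.
Proof.
move=> H sG sD fG fD.
apply: (superset_closed (GS l G')) sD fD _ => [A X|]; first exact: GS_weakR.
by apply: (superset_closed (fun X => GS l X D)) sG fG H => A X; exact: GS_weakL.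
Qed.

Ltac weaken_from G D :=
  apply: (@GS_weaken _ G D);
    [|by subset_tac|by subset_tac|by finite_tac|by finite_tac].

Lemma GSPL_weaken {l G D G' D'} :
  GSPL l G D -> G `<=` G' -> D `<=` D' -> finite_set G' -> finite_set D' ->
  GSPL l G' D'.
Proof.
move=> H sG sD fG fD.
apply: (superset_closed (GSPL l G')) sD fD _ => [A X|].
  exact: GSPL_weakR.
by apply: (superset_closed (fun X => GSPL l X D)) sG fG H => A X;
  exact: GSPL_weakL.
Qed.

Lemma GS_finite {l G D} : GS l G D -> finite_set G /\ finite_set D.
Proof.
elim=> {l G D}; intros; repeat match goal with
  | H : _ /\ _ |- _ => case: H => *
  | H : finite_set (_ `|` _) |- _ => rewrite finite_setU in H
  end; by split; finite_tac.
Qed.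

Lemma GS_of_L1 {l G D} : GS L1 G D -> GS l G D.
Proof. by case: l => // /GS_lift. Qed.

(** [F] can be rebuilt from elements of [G] by the left rules for
    conjunction and disjunction, one disjunct being chosen each time. *)
Fixpoint decomposed (G : set mform) (F : mform) : Prop :=
  G F \/ match F with
         | MAnd A B => decomposed G A /\ decomposed G B
         | MOr A B => decomposed G A \/ decomposed G B
         | _ => False
         end.

Lemma decomposed_mem {G : set mform} {F} : G F -> decomposed G F.
Proof. by case: F => [p||A B|A B|A B|A] GF; left. Qed.

Lemma decomposed_sub {G G' F} :
  G `<=` G' -> decomposed G F -> decomposed G' F.
Proof.
move=> sG; elim: F => [p||A IHA B IHB|A IHA B IHB|A IHA B IHB|A IHA] /=;
  have := sG; rewrite /subset; intuition.
Qed.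

(** Weakening and the inversion of the left conjunction and disjunction rules
    in one statement, which is what makes the induction go through although
    contraction is implicit. *)
Lemma GS_inversion {l G D} :
  GS l G D -> forall G' D', finite_set G' -> finite_set D' ->
  (forall F, G F -> decomposed G' F) -> D `<=` D' -> GS l G' D'.
Proof.
have ext H A G' : (forall F, H F -> decomposed G' F) ->
    forall F, (A |` H) F -> decomposed (A |` G') F.
  move=> hH F [->|/hH]; first by apply: decomposed_mem; left.
  by apply: decomposed_sub => ?; right.
have extR (H D' : set mform) A : H `<=` D' -> A |` H `<=` A |` D'.
  by move=> s x [->|/s ?]; [left|right].
elim=> {l G D}.
- move=> l p G' D' fG fD /(_ _ erefl) /= [] // Gp /(_ _ erefl) Dp.
  by apply: GS_weaken (GS_ax l p) _ _ fG fD => x ->.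
- move=> l G' D' fG fD /(_ _ erefl) /= [] // Gp _.
  by apply: GS_weaken (GS_bot l) _ _ fG fD => x // ->.
- by move=> l A G D _ IH G' D' fG fD h s; apply: IH => // F GF; apply: h; right.
- by move=> l A G D _ IH G' D' fG fD h s; apply: IH => // F DF; apply: s; right.
- move=> l A B G D _ IH G' D' fG fD h s.
  have hG F : G F -> decomposed G' F by move=> ?; apply: h; right.
  have /= [GAB|[dA dB]] := h _ (or_introl erefl).
    rewrite -(setU1_absorb GAB); apply: GS_andL; apply: IH => //.
    - by finite_tac.
    - by apply: (ext); exact: (ext).
  by apply: IH => // F [->|[->|/hG]].
- move=> l A B G D _ IHA _ IHB G' D' fG fD h s.
  rewrite -(setU1_absorb (s _ (or_introl erefl))).
  have sD x : D x -> D' x by move=> ?; apply: s; right.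
  by apply: GS_andR; [apply: IHA|apply: IHB] => //;
    [apply: finite_setU1|apply: extR|apply: finite_setU1|apply: extR].
- move=> l A B G D _ IHA _ IHB G' D' fG fD h s.
  have hG F : G F -> decomposed G' F by move=> ?; apply: h; right.
  have /= [GAB|[dA|dB]] := h _ (or_introl erefl).
  + rewrite -(setU1_absorb GAB); apply: GS_orL; [apply: IHA|apply: IHB] => //;
      by [apply: finite_setU1|apply: ext].
  + by apply: IHA => // F [->|/hG].
  + by apply: IHB => // F [->|/hG].
- move=> l A B G D _ IH G' D' fG fD h s.
  rewrite -(setU1_absorb (s _ (or_introl erefl))).
  have sD x : D x -> D' x by move=> ?; apply: s; right.
  by apply: GS_orR; apply: IH => //;
    [do 2 apply: finite_setU1|apply: (extR); apply: (extR)].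
- by move=> G D _ IH G' D' fG fD h s; apply: GS_lift; apply: IH.
- move=> l A B G D _ IHA _ IHB G' D' fG fD h s.
  have hG F : G F -> decomposed G' F by move=> ?; apply: h; right.
  have /= [GAB|//] := h _ (or_introl erefl).
  rewrite -(setU1_absorb GAB); apply: GS_impL.
  + by apply: IHA => //; [apply: finite_setU1|apply: extR].
  + by apply: IHB => //; [apply: finite_setU1|apply: ext].
- move=> l A B G D _ IH G' D' fG fD h s.
  rewrite -(setU1_absorb (s _ (or_introl erefl))).
  have sD x : D x -> D' x by move=> ?; apply: s; right.
  by apply: GS_impR; apply: IH => //;
    [apply: finite_setU1|apply: finite_setU1|apply: ext|apply: extR].
- move=> A G H _ G' D' fG fD h s.
  apply: GS_weaken (GS_box H) _ s fG fD => _ [F GF <-].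
  by have [] := h (MBox F); first by exists F.
- move=> A G D _ IH G' D' fG fD h s.
  have hG F : G F -> decomposed G' F by move=> ?; apply: h; right.
  have /= [GAB|//] := h _ (or_introl erefl).
  rewrite -(setU1_absorb GAB); apply: GS_boxL.
  by apply: IH => //; [apply: finite_setU1|apply: ext].
Qed.

(** Each way of resolving every implication of [E], by its conclusion on the
    left or its premise on the right, is a leaf of the tree of left
    implication rules.  Leaves are described by supersets so that repeated
    formulas need no care. *)
Lemma GS_impL_finite {l} {E : set (mform * mform)} : finite_set E ->
  forall G D, finite_set G -> finite_set D ->
  (forall G' D', finite_set G' -> finite_set D' -> G `<=` G' -> D `<=` D' ->
     (forall e, E e -> G' e.2 \/ D' e.1) -> GS l G' D') ->
  GS l ([set MImp e.1 e.2 | e in E] `|` G) D.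
Proof.
move: E; refine (finite_ind _ _ _) => [|e E fE IH] G D fG fD H.
  by rewrite image_set0 set0U; apply: H.
rewrite image_setU image_set1 -setUA; apply: GS_impL.
  apply: IH => //; first exact: finite_setU1.
  move=> G' D' fG' fD' sG sD hE; apply: H => // [x Dx|e' [->|]].
  - by apply: sD; right.
  - by right; apply: sD; left.
  - exact: hE.
weaken_from ([set MImp e.1 e.2 | e in E] `|` (e.2 |` G)) D.
apply: IH => //; first exact: finite_setU1.
  move=> G' D' fG' fD' sG sD hE; apply: H => // [x Gx|e' [->|]].
  + by apply: sG; right.
  + by left; apply: sG; left.
  + exact: hE.
Qed.

(** * From propositional to modal derivations *)

(** Left rules split a translated formula into sets of boxed formulas [T'].
    The Löb rule adds their bodies, and the boxes and bodies together
    determine the formula: this is why a translated context persists under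
    that rule although it is not boxed. *)
Lemma GS_split {l X} : forall T G D,
  finite_set T -> finite_set G -> finite_set D ->
  (forall T', finite_set T' -> T `<=` T' ->
     decomposed (MBox @` T' `|` T') (visser X) -> GS l (MBox @` T' `|` G) D) ->
  GS l (visser X |` (MBox @` T `|` G)) D.
Proof.
elim: X => [p||A IHA B IHB|A IHA B IHB|A IHA B IHB] T G D fT fG fD H /=.
- apply: GS_andL.
  weaken_from (MBox @` (MVar p |` T) `|` G) D.
  apply: H; [exact: finite_setU1|by move=> ? ?; right|].
  right; split; left; first by right; left.
  by left; exists (MVar p) => //; left.
- apply: GS_weaken (GS_bot l) _ _ _ fD => //; by finite_tac.
- apply: GS_andL.
  weaken_from (visser A |` (MBox @` T `|` (visser B |` G))) D.
  apply: IHA => //; first exact: finite_setU1.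
  move=> T1 fT1 sT1 dA.
  weaken_from (visser B |` (MBox @` T1 `|` G)) D.
  apply: IHB => // T2 fT2 sT2 dB.
  apply: H => //; first exact: subset_trans sT2.
  right; split=> //; apply: decomposed_sub dA.
  by apply: setUSS => //; apply: image_subset.
- by apply: GS_orL; [apply: IHA|apply: IHB] => // T' fT' sT' d; apply: H => //;
    right; [left|right].
- weaken_from (MBox @` (MImp (visser A) (visser B) |` T) `|` G) D.
  apply: H; [exact: finite_setU1|by move=> ? ?; right|].
  by left; left; eexists; first by left.
Qed.

Lemma GS_split_set {l S} : finite_set S -> forall T G D,
  finite_set T -> finite_set G -> finite_set D ->
  (forall T', finite_set T' -> T `<=` T' ->
     (forall X, S X -> decomposed (MBox @` T' `|` T') (visser X)) ->
     GS l (MBox @` T' `|` G) D) ->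
  GS l (visser @` S `|` (MBox @` T `|` G)) D.
Proof.
move: S; refine (finite_ind _ _ _) => [|X S fS IH] T G D fT fG fD H.
  by rewrite image_set0 set0U; apply: H.
weaken_from (visser X |` (MBox @` T `|` (visser @` S `|` G))) D.
apply: GS_split => //; first by finite_tac.
move=> T1 fT1 sT1 dX.
weaken_from (visser @` S `|` (MBox @` T1 `|` G)) D.
apply: IH => // T2 fT2 sT2 dS.
apply: H => //; first exact: subset_trans sT2.
move=> Y [->|]; last exact: dS.
by apply: decomposed_sub dX; apply: setUSS => //; apply: image_subset.
Qed.

(** The Löb rule in a context that contains translations besides boxed
    formulas; here splitting and inversion meet. *)
Lemma GS_box_context {S T B} :
  finite_set S -> finite_set T ->
  GS L1 (visser @` S `|` (MBox @` T `|` T) `|` [set MBox B]) [set B] ->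
  GS L1 (visser @` S `|` MBox @` T) [set MBox B].
Proof.
move=> fS fT H; rewrite -(setU0 (MBox @` T)).
apply: GS_split_set => //; try by finite_tac.
move=> T' fT' sT' dS; rewrite setU0; apply: GS_box.
apply: (GS_inversion H) => //; try by finite_tac.
have sub : MBox @` T `|` T `<=` MBox @` T' `|` T'.
  by apply: setUSS => //; apply: image_subset.
move=> F [[[X SX <-]|TF]|->].
- by apply: decomposed_sub (dS _ SX) => ?; left.
- by apply: decomposed_mem; left; apply: sub.
- by apply: decomposed_mem; right.
Qed.

(** Every choice of truth values is the sequence of digits of some number, so
    that the [2 ^ k] premises cover all choices. *)
Lemma digit_surj k (f : nat -> bool) :
  exists2 i, i < 2 ^ k & forall j, j < k -> digit i j = f j.
Proof.
elim: k f => [|k IH] f; first by exists 0.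
have [i ltik Hi] := IH (fun j => f j.+1).
exists (f 0 + i * 2).
  by rewrite expnS mul2n muln2; case: (f 0); rewrite ?ltn_Sdouble ?ltn_double.
case=> [|j] ltj.
  by rewrite /digit expn0 divn1 oddD oddM andbF addbF oddb.
rewrite -(Hi j) // /digit expnS divnMA addnC divnMDl //.
by case: (f 0); rewrite addn0.
Qed.

Lemma visser_inj : injective visser.
Proof.
elim=> [p||A IHA B IHB|A IHA B IHB|A IHA B IHB]
       [q||A' B'|A' B'|A' B'] //= [].
- by move=> ->.
- by case: A'.
- by case: A IHA.
- by move=> /IHA -> /IHB ->.
- by move=> /IHA -> /IHB ->.
- by move=> /IHA -> /IHB ->.
Qed.

Lemma finite_visser {S : set pform} : finite_set (visser @` S) -> finite_set S.
Proof.
move=> fS; apply: sub_finite_set (finite_preimage _ fS).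
  by move=> X SX; exists X.
by move=> X Y _ _; exact: visser_inj.
Qed.

Lemma visser_impR k (C D : 'I_k -> pform) A B S :
  (forall i : 'I_(2 ^ k),
    GS L1
      (visser @` ([set D j | j in [set j : 'I_k | digit i j]] `|` S
                  `|` [set PImp A B; A]))
      (visser @` (B |` [set C j | j in [set j : 'I_k | ~~ digit i j]]))) ->
  GS L1 (visser @` (S `|` [set PImp (C j) (D j) | j in [set: 'I_k]]))
    (visser @` [set PImp A B]).
Proof.
move=> H.
have fS : finite_set S.
  have lt0 : 0 < 2 ^ k by rewrite expn_gt0.
  have [/finite_visser] := GS_finite (H (Ordinal lt0)).
  by rewrite !finite_setU => -[[]].
pose E := range (fun j => (visser (C j), visser (D j))).
have fE : finite_set E by apply: finite_image; exact: finite_finset.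
pose T := [set MImp e.1 e.2 | e in E].
have fT : finite_set T by exact: finite_image.
have -> : visser @` (S `|` [set PImp (C j) (D j) | j in [set: 'I_k]])
    = visser @` S `|` MBox @` T.
  rewrite image_setU; congr (_ `|` _); apply/seteqP; split=> F /=.
    by move=> [_ [j _ <-] <-]; exists (MImp (visser (C j)) (visser (D j))) => //;
      exists (visser (C j), visser (D j)) => //; exists j.
  by move=> [_ [_ [j _ <-] <-] <-]; exists (PImp (C j) (D j)) => //; exists j.
rewrite image_set1; apply: GS_box_context => //.
rewrite -(setU0 [set MImp _ _]); apply: GS_impR.
weaken_from (T `|` (visser @` S `|` [set visser (PImp A B); visser A]))
  [set visser B].
apply: GS_impL_finite => //; try by finite_tac.
move=> G' D' fG' fD' sG sD hE.
have [i lti Hi] := digit_surj k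
  (fun j => if insub j is Some j' then `[< G' (visser (D j')) >] else false).
have {}Hi (j : 'I_k) : digit i j = `[< G' (visser (D j)) >].
  by rewrite Hi // valK.
apply: GS_weaken (H (Ordinal lti)) _ _ fG' fD' => _ [X + <-].
- move=> [[[j /= + <-]|SX]|X2].
  + by rewrite Hi => /asboolP.
  + by apply: sG; left; exists X.
  + by apply: sG; right; case: X2 => ->; [left|right].
- move=> [->|[j /= + <-]]; first exact: sD.
  rewrite Hi => /asboolPn nG.
  by have [] := hE (visser (C j), visser (D j)); first by exists j.
Qed.

Lemma GS_of_GSPL l G D : GSPL l G D -> GS l (visser @` G) (visser @` D).
Proof.
elim=> {l G D} /=.
- move=> l p; rewrite !image_set1; apply: GS_of_L1.
  rewrite -(setU0 [set visser _]); apply: GS_andL; apply: GS_andR.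
    by weaken_from [set MVar p] [set MVar p]; exact: GS_ax.
  weaken_from (MBox @` [set MVar p]) [set MBox (MVar p)].
  apply: GS_box.
  by weaken_from [set MVar p] [set MVar p]; exact: GS_ax.
- by move=> l; rewrite image_set1 image_set0; exact: GS_bot.
- by move=> l A G D _ IH; rewrite image_setU image_set1; exact: GS_weakL.
- by move=> l A G D _ IH; rewrite image_setU image_set1; exact: GS_weakR.
- move=> l A B G D _; rewrite !image_setU !image_set1; exact: GS_andL.
- move=> l A B G D _ + _; rewrite !image_setU !image_set1; exact: GS_andR.
- move=> l A B G D _ + _; rewrite !image_setU !image_set1; exact: GS_orL.
- move=> l A B G D _; rewrite !image_setU !image_set1; exact: GS_orR.
- by move=> G D _; exact: GS_lift.
- move=> A B G D _ + _; rewrite !image_setU !image_set1 => IHA IHB.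
  by apply: GS_boxL; exact: GS_impL.
- by move=> k C D A B S _; exact: visser_impR.
Qed.

(** * From modal to propositional derivations *)

(** What the antecedent formula [F] demands of a propositional sequent
    [G => D] that reads it.  The body of an implication is read as the
    disjunction that its left rule produces. *)
Definition readL (G D : set pform) (F : mform) : Prop :=
  [\/ exists2 X, F = visser X & G X,
      exists2 p, F = MVar p \/ F = MBox (MVar p) & G (PVar p)
    | exists X Y, F = MImp (visser X) (visser Y) /\ (G Y \/ D X)].

(** A boxed variable is unreadable on the right.  Reading it as the variable
    would be unsound: boxed falsum entails every boxed variable at level 1,
    whereas [PImp X PBot] with [X] provable does not entail [PVar p]. *)
Definition readR (G D : set pform) (F : mform) : Prop :=
  [\/ exists2 X, F = visser X & D X,
      exists2 p, F = MVar p & D (PVar p)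
    | exists X Y, F = MImp (visser X) (visser Y) /\ (G X /\ D Y)].

Lemma readL_sub {G D G' D' F} : G `<=` G' -> D `<=` D' ->
  readL G D F -> readL G' D' F.
Proof.
move=> sG sD [[X -> /sG]|[p e /sG]|[X [Y [-> []]]]].
- by move=> GX; apply: Or31; exists X.
- by move=> Gp; apply: Or32; exists p.
- by move=> /sG GY; apply: Or33; exists X, Y; split; [|left].
- by move=> /sD DX; apply: Or33; exists X, Y; split; [|right].
Qed.

Lemma readR_sub {G D G' D' F} : G `<=` G' -> D `<=` D' ->
  readR G D F -> readR G' D' F.
Proof.
move=> sG sD [[X -> /sD]|[p e /sD]|[X [Y [-> [/sG GX /sD DY]]]]].
- by move=> DX; apply: Or31; exists X.
- by move=> Dp; apply: Or32; exists p.
- by apply: Or33; exists X, Y.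
Qed.

(** The SPL rule applied to all implications of [G] at once, keeping [G]
    itself as the context [Sigma].  Stating its premises through supersets
    [G'] and [D'], as in [GS_impL_finite], hides the digits and matches the
    form of [readL]. *)
Lemma GSPL_impR_all G A B : finite_set G ->
  (forall G' D', finite_set G' -> finite_set D' -> G `<=` G' ->
     G' (PImp A B) -> G' A -> D' B ->
     (forall X Y, G (PImp X Y) -> G' Y \/ D' X) -> GSPL L1 G' D') ->
  GSPL L1 G [set PImp A B].
Proof.
move=> fG H.
pose P := (fun e => PImp e.1 e.2) @^-1` G.
have fP : finite_set P.
  by apply: finite_preimage => // -[a b] [c d] _ _ /= [-> ->].
have [k [f Pf]] := finite_range_ord fP.
have <- : G `|` [set PImp (f j).1 (f j).2 | j in [set: 'I_k]] = G.
  rewrite setUC; apply/setUidPr => _ [j _ <-].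
  have : P (f j) by rewrite Pf; exists j.
  by [].
apply: (GSPL_impR (C := fun j => (f j).1) (D := fun j => (f j).2)) => i.
apply: H.
- by finite_tac; exact: finite_finset.
- by finite_tac; exact: finite_finset.
- by move=> X GX; left; right.
- by right; left.
- by right; right.
- by left.
- move=> X Y GXY.
  have : P (X, Y) by [].
  rewrite Pf => -[j _ fj].
  have [dj|dj] := boolP (digit i j).
    by left; left; left; exists j; rewrite ?fj.
  by right; right; exists j; rewrite ?fj.
Qed.

Lemma readL_box {G D F} : readL G D (MBox F) ->
  (exists2 p, F = MVar p & G (PVar p)) \/
  (exists X Y, F = MImp (visser X) (visser Y) /\ G (PImp X Y)).
Proof.
case=> [[[p||X Y|X Y|X Y] // [->]]|[p [//|[->]]]|[X [Y [//]]]].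
- by right; exists X, Y.
- by left; exists p.
Qed.

Lemma GSPL_of_GS l G D : GS l G D -> forall G' D',
  finite_set G' -> finite_set D' ->
  (forall F, G F -> readL G' D' F) -> (forall F, D F -> readR G' D' F) ->
  GSPL l G' D'.
Proof.
have subU X (S : set pform) : S `<=` X |` S by move=> ? ?; right.
have memL X (G' D' : set pform) : G' X -> readL G' D' (visser X).
  by move=> ?; apply: Or31; exists X.
have memR X (G' D' : set pform) : D' X -> readR G' D' (visser X).
  by move=> ?; apply: Or31; exists X.
elim=> {l G D}.
- move=> l p G' D' fG fD /(_ _ erefl) + /(_ _ erefl).
  case=> [[[] //]|[q [[->]|//] Gq]|[? [? []]] //].
  case=> [[[] //]|[r [<-] Dr]|[? [? []]] //].
  by apply: GSPL_weaken (GSPL_ax l q) _ _ fG fD => x ->.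
- move=> l G' D' fG fD /(_ _ erefl) + _.
  case=> [[[] // _ GB]|[q []] //|[? [? []]] //].
  by apply: GSPL_weaken (GSPL_bot l) _ _ fG fD => x // ->.
- by move=> l A G D _ IH G' D' fG fD h h'; apply: IH => // F ?; apply: h; right.
- by move=> l A G D _ IH G' D' fG fD h h'; apply: IH => // F ?; apply: h'; right.
- move=> l A B G D _ IH G' D' fG fD h h'.
  have hG F : G F -> readL G' D' F by move=> ?; apply: h; right.
  case: (h _ (or_introl erefl)) => [[[p||X Y|X Y|X Y] //]|[q []] //|[? [? []]] //].
  + case=> eA eB Gp; apply: IH => // F [->|[->|/hG //]]; apply: Or32; exists p => //.
      by rewrite eA; left.
    by rewrite eB; right.
  + case=> eA eB GX; rewrite -(setU1_absorb GX); apply: GSPL_andL.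
    apply: IH => //; first by finite_tac.
      move=> F [->|[->|/hG]].
      * by rewrite eA; apply: (memL); left.
      * by rewrite eB; apply: (memL); right; left.
      * by apply: readL_sub => // ? ?; right; right.
    by move=> F /h'; apply: readR_sub => // ? ?; right; right.
- move=> l A B G D _ IHA _ IHB G' D' fG fD h h'.
  have hD F : D F -> readR G' D' F by move=> ?; apply: h'; right.
  case: (h' _ (or_introl erefl)) => [[[p||X Y|X Y|X Y] //]|[q] //|[? [? []]] //].
  + (* The premise with the boxed variable has no reading; the other suffices. *)
    by case=> eA _ Dp; apply: IHA => // F [->|/hD //]; apply: Or32; exists p.
  + case=> eA eB DX; rewrite -(setU1_absorb DX).
    have hL Z F : G F -> readL G' (Z |` D') F by move=> /h; exact: readL_sub.
    have hR Z F : D F -> readR G' (Z |` D') F by move=> /hD; exact: readR_sub.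
    apply: GSPL_andR; [apply: IHA|apply: IHB] => //; try by finite_tac.
    * exact: hL.
    * by move=> F [->|/hR //]; rewrite eA; apply: (memR); left.
    * exact: hL.
    * by move=> F [->|/hR //]; rewrite eB; apply: (memR); left.
- move=> l A B G D _ IHA _ IHB G' D' fG fD h h'.
  have hG F : G F -> readL G' D' F by move=> ?; apply: h; right.
  case: (h _ (or_introl erefl)) => [[[p||X Y|X Y|X Y] //]|[q []] //|[? [? []]] //].
  case=> eA eB GX; rewrite -(setU1_absorb GX).
  have hL Z F : G F -> readL (Z |` G') D' F by move=> /hG; exact: readL_sub.
  have hR Z F : D F -> readR (Z |` G') D' F by move=> /h'; exact: readR_sub.
  apply: GSPL_orL; [apply: IHA|apply: IHB] => //; try by finite_tac.
  + by move=> F [->|/hL //]; rewrite eA; apply: (memL); left.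
  + exact: hR.
  + by move=> F [->|/hL //]; rewrite eB; apply: (memL); left.
  + exact: hR.
- move=> l A B G D _ IH G' D' fG fD h h'.
  have hD F : D F -> readR G' D' F by move=> ?; apply: h'; right.
  case: (h' _ (or_introl erefl)) => [[[p||X Y|X Y|X Y] //]|[q] //|[? [? []]] //].
  case=> eA eB DX; rewrite -(setU1_absorb DX); apply: GSPL_orR.
  apply: IH => //; first by finite_tac.
    by move=> F /h; apply: readL_sub => // ? ?; right; right.
  move=> F [->|[->|/hD]].
  + by rewrite eA; apply: (memR); left.
  + by rewrite eB; apply: (memR); right; left.
  + by apply: readR_sub => // ? ?; right; right.
- by move=> G D _ IH G' D' fG fD h h'; apply: GSPL_lift; apply: IH.
- move=> l A B G D _ IHA _ IHB G' D' fG fD h h'.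
  have hG F : G F -> readL G' D' F by move=> ?; apply: h; right.
  case: (h _ (or_introl erefl)) => [[[] //]|[q []] //|[X [Y [[eA eB] [GY|DX]]]]].
  + by apply: IHB => // F [->|/hG //]; rewrite eB; exact: memL.
  + by apply: IHA => // F [->|/h' //]; rewrite eA; exact: memR.
- move=> l A B G D _ IH G' D' fG fD h h'.
  have hD F : D F -> readR G' D' F by move=> ?; apply: h'; right.
  case: (h' _ (or_introl erefl)) => [[[] //]|[q] //|[X [Y [[eA eB] [GX DY]]]]].
  apply: IH => // F [->|].
  + by rewrite eA; exact: memL.
  + exact: h.
  + by rewrite eB; exact: memR.
  + exact: hD.
- move=> A G _ IH G' D' fG fD h h'.
  case: (h' _ erefl) => [[[p||X Y|X Y|X Y] //]|[q] //|[? [? []]] //].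
  case=> eA DX.
  apply: (@GSPL_weaken _ G' [set PImp X Y]) => //; last by move=> _ ->.
  apply: GSPL_impR_all => // G1 D1 fG1 fD1 sG GXY GX DY branch.
  have {}h F : G F -> _ := fun GF => readL_box (h _ (ex_intro2 _ _ F GF erefl)).
  apply: IH => // F; last first.
    by move=> ->; rewrite eA; apply: Or33; exists X, Y.
  case=> [[[{}F /h + <-]|/h]|->].
  + case=> [[p -> Gp]|[U [V [-> GUV]]]].
      by apply: Or32; exists p; [right|exact: sG].
    by apply: (memL (PImp U V)); exact: sG.
  + case=> [[p -> Gp]|[U [V [-> GUV]]]].
      by apply: Or32; exists p; [left|exact: sG].
    by apply: Or33; exists U, V; split=> //; exact: branch.
  + by rewrite eA; exact: (memL (PImp X Y)).
- move=> A G D _ IH G' D' fG fD h h'.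
  have hG F : G F -> readL G' D' F by move=> ?; apply: h; right.
  case: (readL_box (h _ (or_introl erefl))) => [[p eA Gp]|[X [Y [eA GXY]]]].
    by apply: IH => // F [->|/hG //]; rewrite eA; apply: Or32; exists p => //; left.
  rewrite -(setU1_absorb GXY).
  apply: GSPL_impL; apply: IH => //; try by finite_tac.
  + move=> F [->|/hG]; last exact: readL_sub.
    by rewrite eA; apply: Or33; exists X, Y; split=> //; right; left.
  + by move=> F /h'; exact: readR_sub.
  + move=> F [->|/hG]; last exact: readL_sub.
    by rewrite eA; apply: Or33; exists X, Y; split=> //; left; left.
  + by move=> F /h'; exact: readR_sub.
Qed.

Theorem theorem5p7 (l : level) (Gamma Delta : set pform) :
  GSPL l Gamma Delta <-> GS l (visser @` Gamma) (visser @` Delta).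
Proof.
split=> [|H]; first exact: GS_of_GSPL.
have [/finite_visser fG /finite_visser fD] := GS_finite H.
apply: (GSPL_of_GS _ _ _ H) => // _ [X ? <-]; by apply: Or31; exists X.
Qed.
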